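(* For every $n\ge1$, $\lambda\text{-Indep}^h_n\land\text{Par-Indep}^h_n\models_{\mathrm{all}}\mathrm{NoSig}^e_n$. That is, every relational team and every probabilistic team over $\{m_1,\dots,m_n,o_1,\dots,o_n,\lambda\}$ satisfying $\lambda$-Independence and Parameter Independence satisfies No-Signalling (equivalently, the induced empirical model satisfies No-Signalling).
   Context: A relational team $X$ is a set of assignments with common finite domain; $X(\bar x)=\{s(\bar x):s\in X\}$. A probabilistic team $\mathbb{X}=(X,\mathbb{P})$ is a finite team with a probability distribution $\mathbb{P}\colon X\to(0,1]$. Relational independence atom: $X\models\bar x\perp_{\bar z}\bar y$ iff for all $s,s'\in X$ with $s(\bar z)=s'(\bar z)$ there is $s''\in X$ with $s''(\bar z)=s(\bar z)$, $s''(\bar x)=s(\bar x)$, $s''(\bar y)=s'(\bar y)$ ($\bar z$ may be empty). Probabilistic: $\mathbb{X}\models\bar x\perp_{\bar z}\bar y$ iff $\mathbb{P}(\bar x=\bar a,\bar y=\bar b\mid\bar z=\bar c)=\mathbb{P}(\bar x=\bar a\mid\bar z=\bar c)\mathbb{P}(\bar y=\bar b\mid\bar z=\bar c)$ for all $\bar a\in X(\bar x),\bar b\in X(\bar y),\bar c\in X(\bar z)$. Conjunctions hold iff each conjunct holds. $\psi\models_{\mathrm{all}}\varphi$: the entailment holds over all relational teams and over all probabilistic teams. $\bar m=(m_1,\dots,m_n)$, $\bar z_{-i}$ is $\bar z$ without the $i$-th entry. $\lambda\text{-Indep}^h_n=\bar m\perp\lambda$; $\text{Par-Indep}^h_n=\bigwedge_{i=1}^n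 o_i\perp_{m_i\lambda}\bar m_{-i}$; $\mathrm{NoSig}^e_n=\bigwedge_{i=1}^n o_i\perp_{m_i}\bar m_{-i}$. *)

(* Defs.v *)
From HB Require Import structures.
From mathcomp Require Import all_boot all_order all_algebra finmap.
From mathcomp Require Import boolp classical_sets reals.

Set Implicit Arguments.
Unset Strict Implicit.
Unset Printing Implicit Defensive.

Local Open Scope classical_set_scope.
Local Open Scope ring_scope.

(* The value domain is an arbitrary type, so the eqType and choiceType
   structures needed for finite sets of assignments are the classical ones. *)
Definition assignment (V : finType) (A : Type) : Type := V -> A.

HB.instance Definition _ (V : finType) (A : Type) :=
  gen_eqMixin (assignment V A).
HB.instance Definition _ (V : finType) (A : Type) :=
  gen_choiceMixin (assignment V A).

Definition value (V : finType) (A : Type) (s : assignment V A) (x : seq V) :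
  seq A := map s x.

Definition values (V : finType) (A : Type) (X : set (assignment V A))
  (x : seq V) : set (seq A) := [set value s x | s in X].

Definition rteam (V : finType) (A : Type) : Type := set (assignment V A).

Record pteam (R : realType) (V : finType) (A : Type) := PTeam {
  supp : {fset assignment V A};
  mass : supp -> R;
  mass_range : forall s : supp, 0 < mass s <= 1;
  mass_sum : \sum_(s : supp) mass s = 1
}.

Definition pteam_set (R : realType) (V : finType) (A : Type)
  (X : pteam R V A) : set (assignment V A) := [set` supp X].

Definition Pr (R : realType) (V : finType) (A : Type) (X : pteam R V A)
  (E : set (assignment V A)) : R :=
  \sum_(s : supp X | val s \in E) mass s.

Definition condPr (R : realType) (V : finType) (A : Type) (X : pteam R V A)
  (E F : set (assignment V A)) : R := Pr X (E `&` F) / Pr X F.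

Definition event (V : finType) (A : Type) (x : seq V) (a : seq A) :
  set (assignment V A) := [set s | value s x = a].

(* [Indep x z y] is the atom x _||_z y; the unconditional atom has z = [::]. *)
Inductive formula (V : finType) : Type :=
| Indep of seq V & seq V & seq V
| And of formula V & formula V
| BigAnd (k : nat) of 'I_k -> formula V.
Arguments Indep {V} x z y.

Definition rindep (V : finType) (A : Type) (X : rteam V A)
  (x z y : seq V) : Prop :=
  forall s s', X s -> X s' -> value s z = value s' z ->
  exists s'', [/\ X s'', value s'' z = value s z,
                  value s'' x = value s x & value s'' y = value s' y].

Definition pindep (R : realType) (V : finType) (A : Type) (X : pteam R V A)
  (x z y : seq V) : Prop :=
  forall a b c,
    values (pteam_set X) x a -> values (pteam_set X) y b ->
    values (pteam_set X) z c ->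
    condPr X (event x a `&` event y b) (event z c) =
    condPr X (event x a) (event z c) * condPr X (event y b) (event z c).

Fixpoint rsat (V : finType) (A : Type) (X : rteam V A) (phi : formula V) :
  Prop :=
  match phi with
  | Indep x z y => rindep X x z y
  | And phi1 phi2 => rsat X phi1 /\ rsat X phi2
  | BigAnd _ phis => forall i, rsat X (phis i)
  end.

Fixpoint psat (R : realType) (V : finType) (A : Type) (X : pteam R V A)
  (phi : formula V) : Prop :=
  match phi with
  | Indep x z y => pindep X x z y
  | And phi1 phi2 => psat X phi1 /\ psat X phi2
  | BigAnd _ phis => forall i, psat X (phis i)
  end.

Definition entails_all (R : realType) (V : finType) (psi phi : formula V) :
  Prop :=
  (forall (A : Type) (X : rteam V A), rsat X psi -> rsat X phi) /\
  (forall (A : Type) (X : pteam R V A), psat X psi -> psat X phi).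

(* The variables m_1..m_n, o_1..o_n and lambda, indexed from 0. *)
Definition hvar (n : nat) : finType := ('I_n + 'I_n + unit)%type.
Definition mvar (n : nat) (i : 'I_n) : hvar n := inl (inl i).
Definition ovar (n : nat) (i : 'I_n) : hvar n := inl (inr i).
Definition lvar (n : nat) : hvar n := inr tt.

Definition mbar (n : nat) : seq (hvar n) := [seq mvar i | i <- enum 'I_n].

Definition omit (T : Type) (i : nat) (z : seq T) : seq T :=
  take i z ++ drop i.+1 z.

Definition lambda_indep (n : nat) : formula (hvar n) :=
  Indep (mbar n) [::] [:: lvar n].

Definition par_indep (n : nat) : formula (hvar n) :=
  BigAnd (fun i : 'I_n =>
    Indep [:: ovar i] [:: mvar i; lvar n] (omit i (mbar n))).

Definition no_sig (n : nat) : formula (hvar n) :=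
  BigAnd (fun i : 'I_n => Indep [:: ovar i] [:: mvar i] (omit i (mbar n))).

(* Main.v *)
Require Import Defs.
From mathcomp Require Import all_boot all_order all_algebra reals.
From mathcomp Require Import finmap boolp classical_sets ring.

(** Both halves are instances of one semigraphoid derivation: if [z y] is
    independent of [w] and [x] is independent of [y] given [z w], then [x] is
    independent of [y] given [z]. In the probabilistic case the hypotheses give
    [P(x,y,z,w) P(z) P(w) = P(x,z,w) P(y,z) P(w)]; one cancels [P(w) > 0] and
    sums over the values of [w]. *)

Set Implicit Arguments.
Unset Strict Implicit.
Unset Printing Implicit Defensive.

Import Order.TTheory GRing.Theory Num.Theory.
Local Open Scope classical_set_scope.
Local Open Scope ring_scope.

Lemma eq_value_subset (V : finType) (A : Type) (s t : assignment V A)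
    (x y : seq V) :
  {subset y <= x} -> value s x = value t x -> value s y = value t y.
Proof.
move=> yx st.
have {}st : {in x, s =1 t}.
  elim: x st {yx} => [|v x IH] //= [sv sx] u.
  by rewrite inE => /predU1P[->//|]; apply: IH.
elim: y yx => [|v y IH] //= yx; congr (_ :: _).
  by apply: st; apply: yx; rewrite mem_head.
by apply: IH => u uy; apply: yx; rewrite inE uy orbT.
Qed.

(** The length condition makes the cut in [a ++ b] fall at the cut in [x ++ y]. *)
Lemma event_cat (V : finType) (A : Type) (x y : seq V) (a b : seq A) :
  size a = size x -> event (x ++ y) (a ++ b) = event x a `&` event y b.
Proof.
move=> sa; apply/seteqP; split=> s; rewrite /event /value /= map_cat.
  move=> e; have := congr1 (take (size a)) e; have := congr1 (drop (size a)) e.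
  by rewrite sa !drop_size_cat ?take_size_cat ?size_map.
by case=> -> ->.
Qed.

Lemma event_size (V : finType) (A : Type) (x : seq V) (a : seq A) :
  size a <> size x -> event x a = set0.
Proof.
by move=> sa; apply/seteqP; split=> s //= sx; apply: sa; rewrite -sx size_map.
Qed.

Lemma event_nil (V : finType) (A : Type) :
  event [::] [::] = [set: assignment V A].
Proof. by apply/seteqP; split. Qed.

(** The value of [x] determines that of [y], so one common assignment already forces the
    inclusion. *)
Lemma event_subset (V : finType) (A : Type) (x y : seq V) (a b : seq A) :
  {subset y <= x} ->
  event x a `<=` event y b \/ event y b `&` event x a = set0.
Proof.
move=> yx; have [[s [sy sx]]|h] := pselect (exists s, (event y b `&` event x a) s).
  left=> t /= tx; rewrite -sy; apply: eq_value_subset yx _.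
  by rewrite tx -sx.
by right; apply/seteqP; split=> s // hs; apply: h; exists s.
Qed.

Section Probability.
Variables (R : realType) (V : finType) (A : Type) (X : pteam R V A).
Implicit Types (E F : set (assignment V A)) (x y z w : seq V).

Lemma Pr_set0 : Pr X set0 = 0.
Proof. by rewrite /Pr big_pred0// => s; rewrite in_set0. Qed.

Lemma Pr_setT : Pr X setT = 1.
Proof. by rewrite -(mass_sum X); apply: eq_bigl => s; rewrite in_setT. Qed.

Lemma Pr_gt0 E s : pteam_set X s -> E s -> 0 < Pr X E.
Proof.
move=> Xs Es; rewrite /Pr (bigD1 [` Xs]%fset) /=; last by rewrite inE.
apply: ltr_wpDr; last by case/andP: (mass_range [` Xs]%fset).
by apply: sumr_ge0 => t _; case/andP: (mass_range t) => /ltW.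
Qed.

Lemma Pr_neq0 E : Pr X E != 0 -> exists2 s, pteam_set X s & E s.
Proof.
move=> E0; apply: contrapT => h; move/eqP: E0; apply.
rewrite /Pr big1// => s; rewrite inE => Es.
by case: h; exists (val s) => //; exact: valP.
Qed.

Lemma Pr_eq0_subset E F : F `<=` E -> Pr X E = 0 -> Pr X F = 0.
Proof.
move=> FE E0; apply/eqP; apply: contraT => /Pr_neq0[s Xs /FE Es].
by have := Pr_gt0 Xs Es; rewrite E0 ltxx.
Qed.

Lemma Pr_event_neq0 x a : Pr X (event x a) != 0 -> values (pteam_set X) x a.
Proof. by case/Pr_neq0=> s Xs sx; exists s. Qed.

(** Law of total probability, with [D] the finitely many values that [w] takes on the support. As
    [D] does not depend on [E], two probabilities can be expanded over the same list and compared
    term by term. *)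
Lemma Pr_marginal w : exists D : seq (seq A), forall E,
  Pr X E = \sum_(d <- D) Pr X (E `&` event w d).
Proof.
pose f (s : supp X) : seq {classic A} := value (val s) w.
exists (undup (codom f)) => E.
under eq_bigr do rewrite /Pr big_mkcond /=.
rewrite exchange_big /= [LHS]/Pr big_mkcond; apply: eq_bigr => s _.
have fs : f s \in undup (codom f).
  by rewrite mem_undup codom_f.
rewrite (bigD1_seq (f s)) ?undup_uniq//= big1 ?addr0; last first.
  move=> d /eqP df; case: ifPn => //; rewrite inE => -[_ sd].
  by case: df; rewrite -sd.
congr (if _ then _ else _); apply/idP/idP; rewrite !inE; first by split.
by case.
Qed.

(** Clearing denominators removes the restriction to attained values: if [a], [b] or [c] has
    probability zero, both products vanish. *)
Lemma pindepP x z y : pindep X x z y <-> forall a b c,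
  Pr X (event x a `&` event y b `&` event z c) * Pr X (event z c) =
  Pr X (event x a `&` event z c) * Pr X (event y b `&` event z c).
Proof.
split=> [h a b c|h a b c _ _ [s Xs sc]]; last first.
  have c0 : Pr X (event z c) != 0 by rewrite gt_eqF ?(Pr_gt0 Xs).
  rewrite /condPr; apply: (mulIf (mulf_neq0 c0 c0)).
  by rewrite mulrA divfK// h; field.
have [c0|c0] := eqVneq (Pr X (event z c)) 0.
  by rewrite c0 mulr0 (Pr_eq0_subset _ c0) ?mul0r// => s [].
have [a0|a0] := eqVneq (Pr X (event x a)) 0.
  rewrite (Pr_eq0_subset _ a0) ?mul0r; last by move=> s [[]].
  by rewrite (Pr_eq0_subset _ a0) ?mul0r// => s [].
have [b0|b0] := eqVneq (Pr X (event y b)) 0.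
  rewrite (Pr_eq0_subset _ b0) ?mul0r; last by move=> s [[]].
  by rewrite (Pr_eq0_subset (F := event y b `&` _) _ b0) ?mulr0// => s [].
have := h a b c (Pr_event_neq0 a0) (Pr_event_neq0 b0) (Pr_event_neq0 c0).
rewrite /condPr => /(congr1 ( *%R^~ (Pr X (event z c) ^+ 2))) e.
transitivity (Pr X (event x a `&` event y b `&` event z c) / Pr X (event z c)
  * Pr X (event z c) ^+ 2); first by field.
by rewrite e; field.
Qed.

Lemma pindep_nilP x y : pindep X x [::] y <-> forall a b,
  Pr X (event x a `&` event y b) = Pr X (event x a) * Pr X (event y b).
Proof.
split=> [/pindepP h a b|h].
  by have := h a b [::]; rewrite event_nil !setIT Pr_setT mulr1.
apply/pindepP => a b [|u c]; first by rewrite event_nil !setIT Pr_setT mulr1.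
(* A nonempty list is never the value of the empty tuple. *)
by rewrite [event [::] _]event_size// !setI0 Pr_set0 !mul0r.
Qed.

Lemma pindep_nil_subset x x' y : {subset x' <= x} ->
  pindep X x [::] y -> pindep X x' [::] y.
Proof.
move=> x'x /pindep_nilP h; apply/pindep_nilP => a b.
(* Sum over the values [d] of the larger tuple: each [d] either forces [x' = a] or excludes it. *)
have [D hD] := Pr_marginal x.
rewrite hD (hD (event x' a)) mulr_suml; apply: eq_bigr => d _.
rewrite setIAC; have [s|->] := event_subset d a x'x.
  by rewrite (setIidr s) h.
by rewrite set0I Pr_set0 mul0r.
Qed.

Lemma pindep_contraction x z y w :
  pindep X (z ++ y) [::] w -> pindep X x (z ++ w) y -> pindep X x z y.
Proof.
move=> hzy; have /pindep_nilP hz : pindep X z [::] w.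
  by apply: pindep_nil_subset hzy => v; rewrite mem_cat => ->.
move/pindep_nilP: hzy => hzy /pindepP hx; apply/pindepP => a b c.
have [sc|sc] := pselect (size c = size z); last first.
  by rewrite (event_size sc) !setI0 Pr_set0 !mul0r.
have [D hD] := Pr_marginal w.
rewrite hD (hD (event x a `&` _)) !mulr_suml; apply: eq_bigr => d _.
have [d0|d0] := eqVneq (Pr X (event w d)) 0.
  rewrite (Pr_eq0_subset _ d0) ?mul0r; last by move=> s [].
  by rewrite (Pr_eq0_subset _ d0) ?mul0r// => s [].
(* The factor [P(w = d)] merges with [P(z = c)] on the left and with [P(y = b, z = c)] on the right,
   which leaves the product form of the second hypothesis at [c ++ d]. *)
apply: (mulIf d0); rewrite -!mulrA -hz.
have := hzy (c ++ b) d; rewrite event_cat// => hcb.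
rewrite (setIC (event y b)) -hcb.
have := hx a b (c ++ d); rewrite event_cat// => hcd.
rewrite -!setIA in hcd *; rewrite hcd.
by rewrite (setICA (event y b)).
Qed.

End Probability.

Lemma rindep_nil_subset (V : finType) (A : Type) (X : rteam V A)
    (x x' y : seq V) : {subset x' <= x} ->
  rindep X x [::] y -> rindep X x' [::] y.
Proof.
move=> x'x h s s' Xs Xs' e; have [t [Xt _ tx ty]] := h s s' Xs Xs' e.
by exists t; split=> //; apply: eq_value_subset x'x tx.
Qed.

Lemma rindep_contraction (V : finType) (A : Type) (X : rteam V A)
    (x z y w : seq V) :
  rindep X (z ++ y) [::] w -> rindep X x (z ++ w) y -> rindep X x z y.
Proof.
move=> hzy hx s s' Xs Xs' ss'.
(* Swapping [s] and [s'] makes [t] copy [s'] on [z y] and [s] on [w]. Since [s] and [s'] agree on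
   [z], [t] agrees with [s] on [z w], so the second hypothesis applies to [s] and [t]. *)
have [t [Xt _ tzy tw]] := hzy s' s Xs' Xs erefl.
have tz : value t z = value s z.
  rewrite ss'; apply: eq_value_subset tzy => v.
  by rewrite mem_cat => ->.
have ty : value t y = value s' y.
  by apply: eq_value_subset tzy => v; rewrite mem_cat => ->; rewrite orbT.
have st : value s (z ++ w) = value t (z ++ w).
  by rewrite /value !map_cat -!/(value _ _) tz tw.
have [u [Xu uzw ux uy]] := hx s t Xs Xt st.
exists u; split=> //; last by rewrite uy.
by apply: eq_value_subset uzw => v; rewrite mem_cat => ->.
Qed.

Lemma mvar_omit_subset (n : nat) (i : 'I_n) :
  {subset [:: mvar i] ++ omit i (mbar n) <= mbar n}.
Proof.
move=> v; rewrite mem_cat inE mem_cat => /orP[/eqP->|/orP[]].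
- by rewrite map_f ?mem_enum.
- exact: mem_take.
- exact: mem_drop.
Qed.

Theorem theorem4p11 (R : realType) (n : nat) (n_ge1 : (1 <= n)%N) :
  entails_all R (And (lambda_indep n) (par_indep n)) (no_sig n).
Proof.
split=> A X [hl hp] i; have sub := @mvar_omit_subset n i.
(* Contraction is used with [x] as [o_i], [z] as [m_i], [y] as the remaining measurements and [w] as
   [lambda]; [sub] rearranges the full measurement tuple into [z ++ y]. *)
- exact: rindep_contraction (rindep_nil_subset sub hl) (hp i).
- exact: pindep_contraction (pindep_nil_subset sub hl) (hp i).
Qed.
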